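(* Let $D$ be a noncommutative division ring of characteristic $2$ and let $n$ be a positive integer. If $D$ contains at least four elements, then every matrix in $\mathrm{M}_n(D)$ is expressible as a product of four diagonalizable matrices in $\mathrm{M}_n(D)$.
   Context: $\mathrm{M}_n(D)$ is the ring of $n\times n$ matrices over $D$. A square matrix over $D$ is diagonalizable if it is similar over $D$ (conjugate by an invertible matrix over $D$) to a diagonal matrix with entries in $D$. *)

(* Defs.v *)
From HB Require Import structures.
From mathcomp Require Import all_boot all_order all_algebra.

Set Implicit Arguments.
Unset Strict Implicit.
Unset Printing Implicit Defensive.

Import GRing.Theory.
Local Open Scope ring_scope.

(* A unitRingType is nontrivial, and its units are exactly the elements having
   a two-sided inverse. *)
Definition is_division_ring (D : unitRingType) : Prop :=
  forall x : D, x != 0 -> x \is a GRing.unit.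

Definition noncommutative (D : unitRingType) : Prop :=
  exists x y : D, x * y != y * x.

(* MathComp's unitmx, invmx, similar and diagonalizable need a commutative
   coefficient ring (or a field), hence the explicit two-sided inverse Q of the
   change-of-basis matrix P. *)
Definition mx_inverse (D : unitRingType) (n : nat) (P Q : 'M[D]_n) : Prop :=
  P *m Q = 1%:M /\ Q *m P = 1%:M.

Definition similar_mx (D : unitRingType) (n : nat) (A B : 'M[D]_n) : Prop :=
  exists P Q : 'M[D]_n, mx_inverse P Q /\ A = P *m B *m Q.

Definition diagonalizable_mx (D : unitRingType) (n : nat) (A : 'M[D]_n) : Prop :=
  exists2 B : 'M[D]_n, is_diag_mx B & similar_mx A B.

(* Main.v *)
Require Import Defs.
From HB Require Import structures.
From mathcomp Require Import all_boot all_order all_algebra all_fingroup.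

Import GRing.Theory.
Local Open Scope ring_scope.

(** Any square matrix over a division ring is similar to a direct sum of
    companion matrices: bring it to Hessenberg form as far as possible; at the
    first breakdown the matrix is block upper triangular, and Sylvester
    elimination leaves a coupling block with a single nonzero row, at most. If
    that row vanishes the matrix decomposes; otherwise the transpose, over the
    converse ring, has a longer Hessenberg part.

    A companion matrix is similar to a product of two block diagonal matrices
    with blocks of size 1 and 2 (the odd-even ordering of the Fiedler
    factorisation), the 2x2 blocks being companion matrices. If D has four
    elements, a 2x2 companion matrix is a product of two diagonalizable ones,
    which makes four factors in all. *)

(** * Similarity and invertible matrices over a noncommutative ring *)

Section Similarity.
Context {D : unitRingType} {n : nat}.
Implicit Types A B C P Q : 'M[D]_n.

Lemma mx_inverse1 : mx_inverse (1%:M : 'M[D]_n) 1%:M.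
Proof. by split; rewrite mulmx1. Qed.

Lemma mx_inverse_sym P Q : mx_inverse P Q -> mx_inverse Q P.
Proof. by case. Qed.

Lemma mx_inverseM P Q P' Q' :
  mx_inverse P Q -> mx_inverse P' Q' -> mx_inverse (P *m P') (Q' *m Q).
Proof.
move=> [PQ QP] [PQ' QP']; split.
  by rewrite mulmxA -(mulmxA P) PQ' mulmx1.
by rewrite mulmxA -(mulmxA Q') QP mulmx1.
Qed.

Lemma similar_mx_refl A : similar_mx A A.
Proof. by exists 1%:M, 1%:M; split; [exact: mx_inverse1|rewrite mulmx1 mul1mx]. Qed.

Lemma similar_mx_sym A B : similar_mx A B -> similar_mx B A.
Proof.
move=> [P [Q [[PQ QP] ->]]]; exists Q, P; split=> //.
by rewrite !mulmxA QP mul1mx -mulmxA QP mulmx1.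
Qed.

Lemma similar_mx_trans A B C :
  similar_mx A B -> similar_mx B C -> similar_mx A C.
Proof.
move=> [P [Q [PQ ->]]] [P' [Q' [PQ' ->]]].
by exists (P *m P'), (Q' *m Q); split; [exact: mx_inverseM|rewrite !mulmxA].
Qed.

Lemma similar_mx_conj P Q A : mx_inverse P Q -> similar_mx A (Q *m A *m P).
Proof.
by move=> PQ; apply: similar_mx_sym; exists Q, P; split; first exact: mx_inverse_sym.
Qed.

End Similarity.

Lemma mx_inverse_ublock {D : unitRingType} {m n : nat}
    (P Q : 'M[D]_m) (P' Q' : 'M[D]_n) (X : 'M[D]_(m, n)) :
  mx_inverse P Q -> mx_inverse P' Q' ->
  mx_inverse (block_mx P X 0 P') (block_mx Q (- (Q *m X *m Q')) 0 Q').
Proof.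
move=> [PQ QP] [PQ' QP']; split; rewrite mulmx_block !mulmx0 !mul0mx !addr0 !add0r.
  by rewrite mulmxN !mulmxA PQ mul1mx PQ' addNr -scalar_mx_block.
by rewrite mulNmx -!mulmxA QP QP' mulmx1 subrr -scalar_mx_block.
Qed.

Lemma mx_inverse_block {D : unitRingType} {m n : nat}
    (P Q : 'M[D]_m) (P' Q' : 'M[D]_n) :
  mx_inverse P Q -> mx_inverse P' Q' ->
  mx_inverse (block_mx P 0 0 P') (block_mx Q 0 0 Q').
Proof.
move=> PQ PQ'; move: (mx_inverse_ublock _ _ _ _ 0 PQ PQ').
by rewrite mulmx0 mul0mx oppr0.
Qed.

(** Over a noncommutative ring, transposition reverses a product only if the entries are also
    multiplied in the opposite order, hence the converse ring. *)
Lemma trmx_mul_converse {D : unitRingType} {n : nat} (A B : 'M[D^c]_n) :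
  (A *m B)^T = (B^T : 'M[D]_n) *m (A^T : 'M[D]_n).
Proof.
by apply/matrixP=> i j; rewrite !mxE; apply: eq_bigr => k _; rewrite !mxE.
Qed.

Lemma mx_inverse_tr {D : unitRingType} {n : nat} (P Q : 'M[D^c]_n) :
  mx_inverse P Q -> mx_inverse (Q^T : 'M[D]_n) (P^T : 'M[D]_n).
Proof.
have tr1 : (1%:M : 'M[D^c]_n)^T = (1%:M : 'M[D]_n).
  by apply/matrixP=> i j; rewrite !mxE eq_sym.
by move=> [PQ QP]; split; rewrite -trmx_mul_converse ?PQ ?QP tr1.
Qed.

(** * Products of two matrices from a given class *)

(** The class [S] is given in all sizes, so that block sums make sense and the construction can be
    iterated: applied twice, it gives four factors. *)
Definition mx_prod2_of {D : unitRingType}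
    (S : forall n, 'M[D]_n -> Prop) (n : nat) (A : 'M[D]_n) : Prop :=
  exists B C : 'M[D]_n, [/\ S n B, S n C & A = B *m C].

Definition similar_closed {D : unitRingType}
    (S : forall n, 'M[D]_n -> Prop) : Prop :=
  forall n (A B : 'M[D]_n), similar_mx A B -> S n B -> S n A.

Definition block_diag_closed {D : unitRingType}
    (S : forall n, 'M[D]_n -> Prop) : Prop :=
  forall m n (A : 'M[D]_m) (B : 'M[D]_n),
    S m A -> S n B -> S (m + n)%N (block_mx A 0 0 B).

Lemma similar_closed_prod2 {D : unitRingType} (S : forall n, 'M[D]_n -> Prop) :
  similar_closed S -> similar_closed (mx_prod2_of S).
Proof.
move=> Ssim n A B [P [Q [[PQ QP] ->]]] [B1 [B2 [S1 S2 ->]]].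
exists (P *m B1 *m Q), (P *m B2 *m Q); split.
- by apply: Ssim S1; exists P, Q.
- by apply: Ssim S2; exists P, Q.
by rewrite !mulmxA -(mulmxA _ Q) QP mulmx1.
Qed.

Lemma block_diag_closed_prod2 {D : unitRingType}
    (S : forall n, 'M[D]_n -> Prop) :
  block_diag_closed S -> block_diag_closed (mx_prod2_of S).
Proof.
move=> Sbd m n _ _ [A1 [A2 [SA1 SA2 ->]]] [B1 [B2 [SB1 SB2 ->]]].
exists (block_mx A1 0 0 B1), (block_mx A2 0 0 B2); split; try exact: Sbd.
by rewrite mulmx_block !mulmx0 !mul0mx ?addr0 ?add0r.
Qed.

Lemma prod2_trmx {D : unitRingType} {S : forall n, 'M[D]_n -> Prop}
    {S' : forall n, 'M[D^c]_n -> Prop} :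
  (forall n (A : 'M[D^c]_n), S' n A -> S n A^T) ->
  forall n (A : 'M[D^c]_n), mx_prod2_of S' n A -> mx_prod2_of S n A^T.
Proof.
move=> Str n _ [B [C [SB SC ->]]].
by exists C^T, B^T; split; [exact: Str|exact: Str|exact: trmx_mul_converse].
Qed.

Lemma diagonalizable_mx_similar {D : unitRingType} :
  similar_closed (@diagonalizable_mx D).
Proof.
by move=> n A B AB [C dC BC]; exists C => //; apply: similar_mx_trans AB BC.
Qed.

Lemma diagonalizable_mx_block {D : unitRingType} :
  block_diag_closed (@diagonalizable_mx D).
Proof.
move=> m n A B [A' dA [P [Q [PQ ->]]]] [B' dB [P' [Q' [PQ' ->]]]].
exists (block_mx A' 0 0 B').
  by rewrite is_diag_block_mx ?eqxx ?dA.
exists (block_mx P 0 0 P'), (block_mx Q 0 0 Q').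
split; first exact: mx_inverse_block.
by rewrite !mulmx_block !mulmx0 !mul0mx ?addr0 ?add0r ?mul0mx.
Qed.

Lemma diagonalizable_mx_trmx {D : unitRingType} n (A : 'M[D^c]_n) :
  diagonalizable_mx A -> diagonalizable_mx (A^T : 'M[D]_n).
Proof.
move=> [B dB [P [Q [PQ ->]]]]; exists B^T.
  by move: dB; rewrite -is_diag_trmx.
exists Q^T, P^T; split; first exact: mx_inverse_tr.
by rewrite !trmx_mul_converse mulmxA.
Qed.

Lemma diagonalizable_mx_diag {D : unitRingType} {n} (A : 'M[D]_n) :
  is_diag_mx A -> diagonalizable_mx A.
Proof. by move=> dA; exists A => //; exact: similar_mx_refl. Qed.

Notation prod2_diagonalizable := (mx_prod2_of (@diagonalizable_mx _)).
Notation prod4_diagonalizable := (mx_prod2_of prod2_diagonalizable).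

Lemma prod2_diagonalizable_diag {D : unitRingType} {n} (A : 'M[D]_n) :
  is_diag_mx A -> prod2_diagonalizable n A.
Proof.
move=> dA; exists A, 1%:M; rewrite mulmx1; split=> //;
  apply: diagonalizable_mx_diag => //; exact: scalar_mx_is_diag.
Qed.

Lemma prod4_diagonalizable_similar {D : unitRingType} n (A B : 'M[D]_n) :
  similar_mx A B -> prod4_diagonalizable n B -> prod4_diagonalizable n A.
Proof.
exact/similar_closed_prod2/similar_closed_prod2/diagonalizable_mx_similar.
Qed.

Lemma prod4_diagonalizable_trmx {D : unitRingType} n (A : 'M[D^c]_n) :
  prod4_diagonalizable n A -> prod4_diagonalizable n (A^T : 'M[D]_n).
Proof. exact/prod2_trmx/prod2_trmx/diagonalizable_mx_trmx. Qed.

(** The cardinality hypothesis in the form that selects a diagonal entry; it mentions no product, so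
    it reads the same over the converse ring. *)
Definition has_fourth (D : unitRingType) : Prop :=
  forall h : D, exists e, [/\ e != 0, e != 1 & e != h].

(** * Companion matrices of size two *)

Section TwoByTwo.
Context {D : unitRingType} (Ddiv : is_division_ring D).

Let arith01 := (@mulr0 D, @mul0r D, @mulr1 D, @mul1r D, @addr0 D, @add0r D).

Definition mx2 (a b c d : D) : 'M[D]_(1 + 1) :=
  block_mx a%:M b%:M c%:M d%:M.

Lemma mulmx2 a b c d a' b' c' d' :
  mx2 a b c d *m mx2 a' b' c' d' =
  mx2 (a * a' + b * c') (a * b' + b * d') (c * a' + d * c') (c * b' + d * d').
Proof. by rewrite mulmx_block -!scalar_mxM -!raddfD. Qed.

Lemma mx2_1 : mx2 1 0 0 1 = 1%:M.
Proof. by rewrite /mx2 !raddf0 -scalar_mx_block. Qed.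

Lemma mx2_diag a b : is_diag_mx (mx2 a 0 0 b).
Proof.
by rewrite is_diag_block_mx // !raddf0 !eqxx !scalar_mx_is_diag.
Qed.

Lemma mx2_uinverse z : mx_inverse (mx2 1 z 0 1) (mx2 1 (- z) 0 1).
Proof.
by split; rewrite mulmx2 !arith01 ?addNr ?subrr mx2_1.
Qed.

Lemma mx2_linverse z : mx_inverse (mx2 1 0 z 1) (mx2 1 0 (- z) 1).
Proof.
by split; rewrite mulmx2 !arith01 ?addNr ?subrr mx2_1.
Qed.

(** As the other diagonal entry is 1, clearing [y] amounts to [z * (f - 1) = y], a one-sided
    equation solved by division. *)
Lemma diagonalizable_mx2_upper y f : f != 1 -> diagonalizable_mx (mx2 1 y 0 f).
Proof.
move=> f1; exists (mx2 1 0 0 f); first exact: mx2_diag.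
have u : f - 1 \is a GRing.unit by apply: Ddiv; rewrite subr_eq0.
exists (mx2 1 (y / (f - 1)) 0 1), (mx2 1 (- (y / (f - 1))) 0 1).
split; first exact: mx2_uinverse.
rewrite !mulmx2 !arith01.
set z := _ / _.
have -> : - z + z * f = z * (f - 1) by rewrite mulrBr mulr1 addrC.
by rewrite /z divrK.
Qed.

Lemma diagonalizable_mx2_lower x e : e != 1 -> diagonalizable_mx (mx2 1 0 x e).
Proof.
move=> e1; exists (mx2 1 0 0 e); first exact: mx2_diag.
have u : 1 - e \is a GRing.unit by apply: Ddiv; rewrite subr_eq0 eq_sym.
set z := (1 - e)^-1 * x; exists (mx2 1 0 z 1), (mx2 1 0 (- z) 1).
split; first exact: mx2_linverse.
rewrite !mulmx2 !arith01.
have -> : z + e * - z = (1 - e) * z by rewrite mulrBl mul1r mulrN.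
by rewrite /z mulVKr.
Qed.

Lemma mx2_companion_inverse c0 c1 : c0 != 0 ->
  mx_inverse (mx2 0 c0 1 c1) (mx2 (- (c1 / c0)) 1 c0^-1 0).
Proof.
move=> /Ddiv uc0; split; rewrite mulmx2 !arith01 ?mulrV ?mulVr // ?mulNr ?divrK //.
  by rewrite addNr mx2_1.
by rewrite addNr mx2_1.
Qed.

Context (Davoid : has_fourth D).

(* In the basis (e0, e1 - e0) this matrix has a first column with both entries
   equal to 1, hence an LU factorisation whose factors have diagonals (1, e) and
   (1, f); only the product e f = - c0 is prescribed. *)
Lemma prod2_diagonalizable_companion2 c0 c1 :
  prod2_diagonalizable _ (mx2 0 c0 1 c1).
Proof.
(* Excluding [- c0] as a value of [e] is what makes [f] differ from 1. *)
have [e [e0 e1 ec]] := Davoid (- c0).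
have eu := Ddiv _ e0.
pose f := e^-1 * - c0.
have f1 : f != 1.
  by apply: contra_neq ec => fE; rewrite -[LHS]mulr1 -fE /f mulVKr.
apply: (similar_closed_prod2 _ diagonalizable_mx_similar _ _
          (mx2 1 0 1 e *m mx2 1 (c0 + c1 - 1) 0 f)).
  exists (mx2 1 (- 1) 0 1), (mx2 1 (- - 1) 0 1); split; first exact: mx2_uinverse.
  rewrite !mulmx2 !arith01 !mulN1r opprK /f mulVKr //.
  rewrite subKr subrr mul0r add0r; congr mx2.
  have -> : c0 + c1 - 1 - c0 = c1 - 1 by rewrite addrAC [c0 + c1]addrC addrK.
  by rewrite addrC subrK.
by exists (mx2 1 0 1 e), (mx2 1 (c0 + c1 - 1) 0 f); split=> //;
  [exact: diagonalizable_mx2_lower|exact: diagonalizable_mx2_upper].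
Qed.

End TwoByTwo.

(** * Companion matrices and their Fiedler factorisation *)

Definition is_companion {D : unitRingType} {n} (C : 'M[D]_n) : Prop :=
  forall i j : 'I_n, (j.+1 < n)%N -> C i j = (i == j.+1 :> nat)%:R.

Section Fiedler.
Context {D : unitRingType} (Ddiv : is_division_ring D).
Context (Davoid : has_fourth D).

(** The block sum of a 2x2 companion matrix and [X], bracketed as [1 + (1 + n)] so that products
    with nested [add1_mx] blocks compute. *)
Definition mx2_block (c0 c1 : D) {n : nat} (X : 'M[D]_n) : 'M[D]_(1 + (1 + n)) :=
  block_mx 0 (row_mx c0%:M 0) (col_mx 1%:M 0) (block_mx c1%:M 0 0 X).

Lemma mx2_blockE c0 c1 n (X : 'M[D]_n) :
  mx2_block c0 c1 X = block_mx (mx2 0 c0 1 c1) 0 0 X.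
Proof.
have := @block_mxA D 1 1 n 1 1 n 0 c0%:M 0 1%:M c1%:M 0 0 0 X.
by rewrite row_mx0 col_mx0 /= /mx2_block /mx2 raddf0 => ->; rewrite castmx_id.
Qed.

(** One Fiedler step: the top two coefficients of the last column move into a 2x2 block, and a
    single 1 replaces them in [C'], which is therefore invertible even if [C 0 ord_max] vanishes. *)
Lemma companion_factor n (C : 'M[D]_(1 + (1 + n))) :
  is_companion C ->
  exists c1 (C' : 'M[D]_(1 + n)),
    [/\ is_companion C', C' 0 ord_max = 1 &
        C = mx2_block (C 0 ord_max) c1 1%:M *m block_mx 1%:M 0 0 C'].
Proof.
move=> compC.
pose t : 'rV[D]_(1 + n) := delta_mx 0 ord_max.
pose b := dsubmx (drsubmx C).
pose c1 := C (rshift 1 0) ord_max.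
(* A prescribed 1 in a column after the first lies below the top two rows, so in these columns the
   top two rows vanish except in the last one. *)
have last_row (i : 'I_(1 + (1 + n))) (j : 'I_(1 + n)) : (i <= 1)%N ->
    C i (rshift 1 j) = C i ord_max * t 0 j.
  move=> i1; rewrite mxE eqxx /=; have [->|jn] := eqVneq j ord_max.
    by rewrite mulr1; congr (C i _); apply: val_inj.
  have jltn : (j < n)%N.
    by move: jn (ltn_ord j); rewrite -val_eqE /= ltnS leq_eqVlt; case: eqP.
  by rewrite mulr0 compC //= ltn_eqF // ltnS (leq_trans i1).
exists c1, (col_mx t b); split.
- move=> i j jn; rewrite mxE; case: split_ordP => i' ->.
    by rewrite ord1 mxE eqxx -val_eqE /= ltn_eqF.
  by rewrite !mxE compC.
- rewrite mxE; case: split_ordP => [i' _|i' /(congr1 val)//].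
  by rewrite ord1 mxE !eqxx.
rewrite mulmx_block !mul0mx !mulmx0 !mulmx1 !addr0 !add0r.
rewrite mul_row_col mul0mx addr0 mul_block_col !mul0mx addr0 add0r mul1mx.
rewrite -[LHS]submxK; congr block_mx.
- by apply/matrixP => i j; rewrite !mxE compC //= !ord1.
- apply/matrixP => i j; rewrite mul_scalar_mx !mxE ord1 last_row // mxE.
  by congr (C _ _ * _); apply: val_inj.
- apply/matrixP => i j; rewrite ord1 !mxE compC //=.
  by case: split_ordP => i' ->; rewrite !mxE ?ord1.
rewrite -[LHS]vsubmxK; congr col_mx.
apply/matrixP => i j; rewrite mul_scalar_mx !mxE ord1 last_row // mxE.
by congr (C _ _ * _); apply: val_inj.
Qed.

Notation add1_mx A := (block_mx (1%:M : 'M_1) 0 0 A).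

Lemma add1_mxM n (A B : 'M[D]_n) : add1_mx (A *m B) = add1_mx A *m add1_mx B.
Proof. by rewrite mulmx_block !mulmx0 !mul0mx !addr0 add0r mulmx1. Qed.

Lemma mx_inverse_add1 n (P Q : 'M[D]_n) :
  mx_inverse P Q -> mx_inverse (add1_mx P) (add1_mx Q).
Proof. exact: mx_inverse_block mx_inverse1. Qed.

Lemma prod2_diagonalizable_add1 n (A : 'M[D]_n) :
  prod2_diagonalizable n A -> prod2_diagonalizable (1 + n) (add1_mx A).
Proof.
apply: block_diag_closed_prod2 diagonalizable_mx_block _ _ _ _ _.
exact/prod2_diagonalizable_diag/scalar_mx_is_diag.
Qed.

Lemma mx2_block_mulr c0 c1 n (X A : 'M[D]_n) :
  mx2_block c0 c1 X *m add1_mx (add1_mx A) = mx2_block c0 c1 (X *m A).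
Proof.
rewrite /mx2_block !mulmx_block !mul0mx !mulmx0 !add0r.
by rewrite mul_row_block mul_col_mx !mulmx0 !mul0mx !addr0 !mulmx1.
Qed.

Lemma mx2_block_mull c0 c1 n (X A : 'M[D]_n) :
  add1_mx (add1_mx A) *m mx2_block c0 c1 X = mx2_block c0 c1 (A *m X).
Proof.
rewrite /mx2_block !mulmx_block !mul0mx !mulmx0 !add0r !addr0.
by rewrite mul_mx_row mul_block_col !mulmx0 !mul0mx !mul1mx !addr0.
Qed.

Lemma prod2_diagonalizable_mx2_block c0 c1 n (X : 'M[D]_n) :
  prod2_diagonalizable n X ->
  prod2_diagonalizable (1 + (1 + n)) (mx2_block c0 c1 X).
Proof.
move=> pX; rewrite mx2_blockE.
apply: (block_diag_closed_prod2 _ diagonalizable_mx_block (1 + 1)%N n) pX.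
exact: prod2_diagonalizable_companion2.
Qed.

(* The conjugating matrix add1_mx P fixes the first basis vector, so that it
   commutes with the 2x2 factor split off at the next step. *)
Definition companion_split n (C : 'M[D]_(1 + n)) : Prop :=
  exists (P Q X Xi : 'M[D]_n) (Y Yi : 'M[D]_(1 + n)),
    [/\ mx_inverse P Q, mx_inverse X Xi, mx_inverse Y Yi,
        prod2_diagonalizable n X /\ prod2_diagonalizable (1 + n) Y &
        C = add1_mx P *m (add1_mx X *m Y) *m add1_mx Q].

(** The first factor of [C'] acts from the third coordinate on, so it merges with the new 2x2 block.
    The splitting of [C'] is a hypothesis so that the step also applies when [C 0 ord_max]
    vanishes. *)
Lemma companion_split_step n (C : 'M[D]_(1 + (1 + n))) :
  is_companion C ->
  (forall C' : 'M[D]_(1 + n),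
     is_companion C' -> C' 0 ord_max = 1 -> companion_split _ C') ->
  exists c1 (P Q X Xi : 'M[D]_n) (Y Yi : 'M[D]_(1 + n)),
    [/\ mx_inverse P Q, mx_inverse X Xi, mx_inverse Y Yi,
        prod2_diagonalizable n X /\ prod2_diagonalizable (1 + n) Y &
        C = add1_mx (add1_mx P) *m (mx2_block (C 0 ord_max) c1 X *m add1_mx Y)
              *m add1_mx (add1_mx Q)].
Proof.
move=> compC split_C'; have [c1 [C' [compC' C'1 CE]]] := companion_factor _ _ compC.
have [P [Q [X [Xi [Y [Yi [PQ XX YY pXY C'E]]]]]]] := split_C' _ compC' C'1.
exists c1, P, Q, X, Xi, Y, Yi; split=> //; rewrite {1}CE C'E !add1_mxM.
by rewrite !mulmxA mx2_block_mulr mul1mx mx2_block_mulr mx2_block_mull.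
Qed.

(** The 2x2 blocks go alternately to the two factors, which swap roles at each step. The nonzero
    corner makes the new second factor invertible, as the next swap conjugates by it. *)
Lemma companion_mx_split n (C : 'M[D]_(1 + n)) :
  is_companion C -> C 0 ord_max != 0 -> companion_split _ C.
Proof.
elim: n C => [|n IHn] C compC C0.
  have CE : C = (C 0 ord_max)%:M.
    by rewrite [LHS]mx11_scalar; congr (C _ _)%:M; apply: val_inj.
  have uC := Ddiv _ C0.
  exists 1%:M, 1%:M, 1%:M, 1%:M, C, ((C 0 ord_max)^-1)%:M; split.
  - exact: mx_inverse1.
  - exact: mx_inverse1.
  - by rewrite {1}CE; split; rewrite -scalar_mxM ?mulrV ?mulVr.
  - split; apply: prod2_diagonalizable_diag.
      exact: scalar_mx_is_diag.
    exact: mx11_is_diag.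
  by rewrite -!scalar_mx_block !mul1mx mulmx1.
have C'_split (C' : 'M[D]_(1 + n)) :
    is_companion C' -> C' 0 ord_max = 1 -> companion_split _ C'.
  by move=> compC' C'1; apply: IHn; rewrite // C'1 oner_neq0.
have [c1 [P [Q [X [Xi [Y [Yi [PQ XX YY [pX pY] CE]]]]]]]] :=
  companion_split_step _ _ compC C'_split.
(* Conjugation by Y exchanges the two factors, Z Y = Y^-1 (Y Z) Y; the new first
   factor then leaves the first basis vector alone. *)
exists (add1_mx P *m Yi), (Y *m add1_mx Q), Y, Yi, (mx2_block (C 0 ord_max) c1 X).
exists (block_mx (mx2 (- (c1 / C 0 ord_max)) 1 (C 0 ord_max)^-1 0) 0 0 Xi); split=> //.
- by apply: mx_inverseM; [exact: mx_inverse_add1|exact: mx_inverse_sym].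
- rewrite mx2_blockE; apply: (@mx_inverse_block D (1 + 1) n) => //.
  exact: mx2_companion_inverse.
- by split=> //; exact: prod2_diagonalizable_mx2_block.
have [_ YiY] := YY.
have YiYK : add1_mx (add1_mx P) *m add1_mx Yi *m add1_mx Y = add1_mx (add1_mx P).
  by rewrite -mulmxA -add1_mxM YiY -scalar_mx_block mulmx1.
by rewrite {1}CE !add1_mxM !mulmxA YiYK.
Qed.

(** The topmost 2x2 block may be singular: the last step involves no swap, and the matrix below that
    block has corner 1. *)
Lemma prod4_diagonalizable_companion n (C : 'M[D]_n) :
  is_companion C -> prod4_diagonalizable n C.
Proof.
case: n C => [|[|n]] C compC.
- exists 0, 0; split; rewrite ?[C]flatmx0 ?[RHS]flatmx0 //;
    apply: prod2_diagonalizable_diag; exact: mx0_is_diag.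
- exists C, 1%:M; rewrite mulmx1; split=> //; apply: prod2_diagonalizable_diag;
  exact: mx11_is_diag.
have C'_split (C' : 'M[D]_(1 + n)) :
    is_companion C' -> C' 0 ord_max = 1 -> companion_split _ C'.
  by move=> compC' C'1; apply: companion_mx_split; rewrite // C'1 oner_neq0.
have [c1 [P [Q [X [Xi [Y [Yi [PQ _ _ [pX pY] CE]]]]]]]] :=
  companion_split_step _ C compC C'_split.
apply: (prod4_diagonalizable_similar _ _ (mx2_block (C 0 ord_max) c1 X *m add1_mx Y)).
  exists (add1_mx (add1_mx P)), (add1_mx (add1_mx Q)); split=> //.
  exact/mx_inverse_add1/mx_inverse_add1.
exists (mx2_block (C 0 ord_max) c1 X), (add1_mx Y); split=> //.
  exact: prod2_diagonalizable_mx2_block.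
exact: prod2_diagonalizable_add1.
Qed.

End Fiedler.

(* Only the first k - 1 columns are constrained, so k = 1 is no condition. *)
Definition hessenberg_upto {D : unitRingType} {n} (k : nat) (A : 'M[D]_n) : Prop :=
  forall i j : 'I_n, (j.+1 < k)%N ->
    ((j.+1 < i)%N -> A i j = 0) /\ (i = j.+1 :> nat -> A i j != 0).

(** * Hessenberg reduction, cyclic vectors and Sylvester elimination *)

Section Hessenberg.
Context {D : unitRingType} (Ddiv : is_division_ring D).

Lemma utriangular_inverse n (P : 'M[D]_n) :
  (forall i j : 'I_n, (j < i)%N -> P i j = 0) -> (forall i, P i i != 0) ->
  exists Q, mx_inverse P Q.
Proof.
elim: n P => [|n IHn] P Ptri Pdiag.
  by exists 0; split; apply/matrixP => -[].
pose a := P 0 0; pose r := ursubmx (P : 'M_(1 + n)).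
pose T := drsubmx (P : 'M_(1 + n)).
have [|i|T' [TT' T'T]] := IHn T.
- by move=> i j ij; rewrite !mxE Ptri.
- by rewrite !mxE.
have ua : a \is a GRing.unit by apply/Ddiv/Pdiag.
have PE : P = block_mx a%:M r 0 T :> 'M_(1 + n).
  rewrite -[LHS](@submxK _ 1 n 1 n); congr block_mx.
    by rewrite [LHS]mx11_scalar !mxE; congr (P _ _)%:M; apply: val_inj.
  by apply/matrixP => i j; rewrite !mxE Ptri //= ord1.
exists (block_mx (a^-1)%:M (- ((a^-1)%:M *m r *m T')) 0 T' : 'M_(1 + n)).
rewrite PE; apply: (@mx_inverse_ublock D 1 n) => //.
by split; rewrite -scalar_mxM ?mulrV ?mulVr.
Qed.

(** The first basis vector is cyclic: its iterates [v j] under [A] form an upper triangular matrix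
    with nonzero diagonal, hence a basis. *)
Lemma hessenberg_similar_companion n (A : 'M[D]_n) :
  hessenberg_upto n A -> exists2 C, similar_mx A C & is_companion C.
Proof.
case: n A => [|n] A hessA.
  by exists A; [exact: similar_mx_refl|case].
pose v j : 'cV[D]_n.+1 := iter j (mulmx A) (delta_mx 0 0).
have v_low j (i : 'I_n.+1) : (j < n.+1)%N ->
    ((j < i)%N -> v j i 0 = 0) /\ (i = j :> nat -> v j i 0 != 0).
  elim: j i => [|j IHj] i jn.
    split; first by move=> i0; rewrite mxE -val_eqE /= gtn_eqF.
    by move=> i0; rewrite mxE -val_eqE /= i0 oner_neq0.
  rewrite /v iterS -/(v j) mxE; split=> ij.
    rewrite big1 // => l _; have [jl|lj] := ltnP j l.
      by rewrite (proj1 (IHj l (ltnW jn))) // mulr0.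
    by rewrite (proj1 (hessA i l (leq_ltn_trans lj jn))) ?mul0r // (leq_ltn_trans _ ij).
  pose j' := Ordinal (ltnW jn).
  (* Only the term at [j] survives: [v j] vanishes after [j], and row [j.+1] of [A] vanishes before
     [j]. *)
  rewrite (bigD1 j') //= big1 ?addr0 => [|l lj].
    have [_ Aij] := hessA i j' jn; have [_ vj] := IHj j' (ltnW jn).
    have uA := Ddiv _ (Aij ij); have uv := Ddiv _ (vj erefl).
    apply: contraNneq (oner_neq0 D) => E0.
    by rewrite -(mulVr uA) -[A i j'](mulrK uv) E0 mul0r mulr0.
  have [jl|lj'] := ltnP j l.
    by rewrite (proj1 (IHj l (ltnW jn))) // mulr0.
  have lj2 : (l < j)%N by rewrite ltn_neqAle lj' andbT.
  by rewrite (proj1 (hessA i l (leq_ltn_trans lj' jn))) ?mul0r // ij ltnS.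
pose P : 'M[D]_n.+1 := \matrix_(i, j) v j i 0.
have [Q [PQ QP]] : exists Q, mx_inverse P Q.
  apply: utriangular_inverse => [i j ij|i]; rewrite mxE.
    by have [->] := v_low j i (ltn_ord j).
  by have [_ ->] := v_low i i (ltn_ord i).
exists (Q *m A *m P); first exact: similar_mx_conj.
move=> i j jn; pose j1 := Ordinal jn.
have colPE l : col l P = v l by apply/colP => x; rewrite !mxE.
have colE0 (B : 'M[D]_n.+1) l : B i l = (col l B) i 0 by rewrite mxE.
(* [A] sends [v j] to [v j.+1], so column [j] of [A *m P] is the next column of [P]. *)
have -> : (Q *m A *m P) i j = (Q *m P) i j1.
  by rewrite !colE0 !colE -!mulmxA -!colE !colPE.
by rewrite QP mxE.
Qed.

Lemma similar_mx_transvection n (z : 'cV[D]_n) (f : 'rV[D]_n) (A : 'M[D]_n) :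
  f *m z = 0 ->
  similar_mx A ((1%:M - z *m f) *m A *m (1%:M + z *m f)).
Proof.
move=> fz; have zf2 : z *m f *m (z *m f) = 0.
  by rewrite mulmxA -(mulmxA z) fz mulmx0 mul0mx.
apply: similar_mx_conj; split.
  by rewrite mulmxBr mulmx1 mulmxDl mul1mx zf2 addr0 addrK.
by rewrite mulmxBl mul1mx mulmxDr mulmx1 zf2 addr0 addrK.
Qed.

(** The right factor leaves alone the columns where [f] vanishes, so there the conjugation is a mere
    row operation. *)
Lemma transvection_conjE n (z : 'cV[D]_n) (f : 'rV[D]_n) (A : 'M[D]_n) x y :
  f 0 y = 0 ->
  ((1%:M - z *m f) *m A *m (1%:M + z *m f)) x y =
  A x y - z x 0 * (f *m A) 0 y.
Proof.
move=> fy; rewrite mulmxDr mulmx1 mulmxBl mul1mx mulmxA [LHS]mxE.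
rewrite [X in _ + X]mxE big_ord1 fy mulr0 addr0 -mulmxA.
by rewrite [LHS]mxE [X in _ + X]mxE [X in - X]mxE big_ord1.
Qed.

(** Gaussian elimination in column [k] below the diagonal. Each [f] is supported beyond [k], so the
    columns up to [k] undergo row operations only. *)
Lemma hessenberg_extend n k (A : 'M[D]_n) (i0 j0 : 'I_n) :
  hessenberg_upto k.+1 A -> j0 = k :> nat -> (k < i0)%N -> A i0 j0 != 0 ->
  exists2 B, similar_mx A B & hessenberg_upto k.+2 B.
Proof.
move=> hessA j0k ki0 A0.
pose i1 := Ordinal (leq_ltn_trans ki0 (ltn_ord i0)).
(* If the pivot vanishes, row [i0] is added to row [i1]; this preserves the columns before [k],
   where row [i0] is zero. *)
wlog Ai1 : A hessA A0 / A i1 j0 != 0.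
  move=> IH; have [Ai1|] := eqVneq (A i1 j0) 0; last exact: IH.
  have i01 : i0 != i1 by apply: contra_neq A0 => ->.
  have i1i0 : (i1 < i0)%N by rewrite ltn_neqAle ki0 andbT eq_sym.
  pose z : 'cV[D]_n := delta_mx i1 0; pose f : 'rV[D]_n := - delta_mx 0 i0.
  have fz : f *m z = 0.
    by rewrite mulNmx mul_delta_mx_0 ?oppr0.
  pose B := (1%:M - z *m f) *m A *m (1%:M + z *m f).
  have BE (x y : 'I_n) : (y <= k)%N -> B x y = A x y + (x == i1)%:R * A i0 y.
    move=> yk; rewrite transvection_conjE; last first.
      rewrite !mxE /= (_ : y == i0 = false) ?oppr0 //.
      by apply/negbTE; rewrite -val_eqE ltn_eqF // (leq_ltn_trans yk).
    by rewrite mulNmx -rowE !mxE andbT mulrN opprK.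
  have [|||C BC hessC] := IH B.
  - move=> x y yk; rewrite BE; last exact: ltnW.
    rewrite (proj1 (hessA i0 y yk)) ?(leq_ltn_trans _ ki0) //.
    by rewrite mulr0 addr0; exact: hessA.
  - by rewrite BE ?j0k // (negbTE i01) mul0r addr0.
  - by rewrite BE ?j0k // eqxx mul1r Ai1 add0r.
  exists C => //; apply: similar_mx_trans BC; exact: similar_mx_transvection.
have uA := Ddiv _ Ai1.
(* Multiples of the pivot row clear column [k] below row [k.+1]. *)
pose z : 'cV[D]_n := \col_x (if (k.+1 < x)%N then A x j0 / A i1 j0 else 0).
pose f : 'rV[D]_n := delta_mx 0 i1.
have fz : f *m z = 0.
  by rewrite -rowE; apply/matrixP => x y; rewrite !mxE ltnn.
exists ((1%:M - z *m f) *m A *m (1%:M + z *m f)).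
  exact: similar_mx_transvection.
move=> x y; rewrite ltnS => yk; rewrite transvection_conjE; last first.
  by rewrite mxE (_ : y == i1 = false) // -val_eqE ltn_eqF.
rewrite -rowE !mxE.
move: yk; rewrite leq_eqVlt => /orP[/eqP [yk]|yk].
  have -> : y = j0 by apply: ord_inj; rewrite j0k.
  rewrite j0k; split=> [->|xk]; first by rewrite divrK // subrr.
  by rewrite xk ltnn mul0r subr0 (_ : x = i1) //; apply: val_inj.
rewrite (proj1 (hessA i1 y _)) //.
by rewrite mulr0 subr0; exact: hessA.
Qed.

(** Rows are cleared from the bottom up: the nonzero subdiagonal entry in row [p] lets row [p - 1]
    of [X] cancel row [p]. No row of [X] is left for row 0. *)
Lemma hessenberg_sylvester k m (M : 'M[D]_k.+1) (A : 'M[D]_m) (R : 'M[D]_(k.+1, m)) :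
  hessenberg_upto k.+1 M ->
  exists X : 'M[D]_(k.+1, m), forall i, i != 0 -> row i (R + M *m X - X *m A) = 0.
Proof.
move=> hessM.
(* Here [t] counts the bottom rows already cleared. *)
suff: forall t, exists X : 'M[D]_(k.+1, m), forall i : 'I_k.+1,
    (k < i + t)%N -> i != 0 -> row i (R + M *m X - X *m A) = 0.
  by move=> /(_ k.+1)[X XP]; exists X => i; apply: XP; rewrite addnS ltnS leq_addl.
elim=> [|t [X XP]]; first by exists 0 => i; rewrite addn0 ltnNge -ltnS ltn_ord.
have [tk|kt] := ltnP t k; last first.
  exists X => i _ i0; apply: XP => //.
  by rewrite (leq_ltn_trans kt) // -[X in (X < _)%N]add0n ltn_add2r lt0n.
have pk : (k - t < k.+1)%N by rewrite ltnS leq_subr.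
have qk : ((k - t).-1 < k.+1)%N by rewrite (leq_ltn_trans (leq_pred _)).
pose p := Ordinal pk; pose q := Ordinal qk.
have pq : p = q.+1 :> nat by rewrite /= prednK // subn_gt0.
have [_ Mpq] := hessM p q (leq_ltn_trans (eq_leq (esym pq)) pk).
have uM := Ddiv _ (Mpq pq).
pose xi := - ((M p q)^-1 *: row p (R + M *m X - X *m A)).
(* Changing row [q] of [X] does not disturb the rows below [p], since column [q] of [M] vanishes
   there. *)
exists (X + delta_mx q 0 *m xi) => i ki i0.
have rowE' : row i (R + M *m (X + delta_mx q 0 *m xi) - (X + delta_mx q 0 *m xi) *m A)
    = row i (R + M *m X - X *m A) + (M i q *: xi - (i == q)%:R *: (xi *m A)).
  rewrite mulmxDr mulmxDl addrA opprD addrACA linearD /=; congr (_ + _).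
  rewrite linearB /=; congr (_ - _).
    rewrite mulmxA -colE; apply/rowP => y.
    by rewrite !mxE big_ord1 !mxE.
  rewrite -mulmxA; apply/rowP => y.
  by rewrite !mxE big_ord1 !mxE andbT.
rewrite {}rowE'.
have p_le_i : (p <= i)%N by rewrite leq_subLR addnC -ltnS -addnS.
have q_lt_i : (q < i)%N by rewrite -pq.
have -> : (i == q) = false by apply/negbTE; rewrite -val_eqE gtn_eqF.
rewrite scale0r subr0.
have [->|ip] := eqVneq i p.
  by rewrite /xi scalerN scalerA divrr // scale1r subrr.
have p_lt_i : (p < i)%N by rewrite ltn_neqAle p_le_i andbT eq_sym.
rewrite (proj1 (hessM i q _)) -?pq ?ltn_ord //.
rewrite scale0r addr0; apply: XP => //.
by move: p_lt_i; rewrite /= ltn_subLR ?(ltnW tk) // addnC.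
Qed.

End Hessenberg.

(** * Transposition combined with reversal of the leading basis vectors *)

Lemma similar_mx_perm {D : unitRingType} n (s : 'S_n) (A : 'M[D]_n) :
  similar_mx A (\matrix_(i, j) A (s i) (s j)).
Proof.
have -> : \matrix_(i, j) A (s i) (s j) = perm_mx s *m A *m perm_mx s^-1.
  by rewrite -row_permE -col_permE; apply/matrixP => i j; rewrite !mxE.
by apply: similar_mx_conj; split; rewrite -perm_mxM ?mulVg ?mulgV perm_mx1.
Qed.

Definition rev_head {k m : nat} (i : 'I_(k + m)) : 'I_(k + m) :=
  match split i with inl i' => lshift m (rev_ord i') | inr i' => rshift k i' end.

Lemma rev_headK {k m} : involutive (@rev_head k m).
Proof.
move=> i; rewrite /rev_head; case: (split_ordP i) => i' ->.
  by rewrite (unsplitK (inl _ : 'I_k + 'I_m)) rev_ordK.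
by rewrite (unsplitK (inr _ : 'I_k + 'I_m)).
Qed.

Lemma rev_head_lshift {k m} (i : 'I_k) : rev_head (lshift m i) = lshift m (rev_ord i).
Proof. by rewrite /rev_head (unsplitK (inl _ : 'I_k + 'I_m)). Qed.

Lemma rev_head_rshift {k m} (i : 'I_m) : rev_head (rshift k i) = rshift k i.
Proof. by rewrite /rev_head (unsplitK (inr _ : 'I_k + 'I_m)). Qed.

Lemma hessenberg_ulsubmx {D : unitRingType} {k m} (A : 'M[D]_(k + m)) :
  hessenberg_upto k A -> hessenberg_upto k (ulsubmx A).
Proof.
by move=> hessA i j jk; rewrite !mxE; apply: (hessA (lshift m i) (lshift m j)).
Qed.

(* Reversal of the first k basis vectors undoes what transposition does to the
   Hessenberg block. *)
Lemma hessenberg_rev_trmx {D : unitRingType} {k m}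
    (M : 'M[D]_k.+1) (R : 'M[D]_(k.+1, m)) (A : 'M[D]_m) :
  hessenberg_upto k.+1 M -> (forall i, i != 0 -> row i R = 0) ->
  hessenberg_upto k.+1
    (\matrix_(i, j) (block_mx M R 0 A) (rev_head j) (rev_head i) : 'M[D^c]_(k.+1 + m)).
Proof.
move=> hessM R0 x y; case: (split_ordP y) => y' -> yk; last first.
  by move: yk; rewrite /= ltnS ltnNge (leq_trans (leqnSn k)) ?leq_addr.
rewrite ltnS /= in yk.
rewrite mxE rev_head_lshift; case: (split_ordP x) => x' ->; last first.
  (* Row 0 of [R] lands in column [k], just past the constrained columns; the other rows are
     zero. *)
  rewrite rev_head_rshift block_mxEur; split=> [_|xy].
    have /R0/rowP/(_ x') : rev_ord y' != 0.
      by rewrite -val_eqE /= subSS subn_eq0 -ltnNge.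
    by rewrite !mxE.
  by move: yk; rewrite -xy /= ltnNge leq_addr.
rewrite rev_head_lshift block_mxEul.
have rev_lt : (0 < x')%N -> ((rev_ord x').+1 < k.+1)%N.
  by move=> x0; rewrite /= subSS ltnS ltn_subrL x0 (leq_ltn_trans _ yk).
split=> /= xy.
  rewrite (proj1 (hessM (rev_ord y') (rev_ord x') (rev_lt _))) //.
    by rewrite (leq_trans _ xy).
  rewrite /= !subSS -subSn -1?ltnS // -[(k - y')%N]subSS.
  by apply: ltn_sub2l.
apply: (proj2 (hessM (rev_ord y') (rev_ord x') (rev_lt _))).
  by rewrite xy.
by rewrite /= !subSS xy subnSK.
Qed.

(** * Induction on the size and on the Hessenberg part *)

Lemma prod4_diagonalizable_all n (D : unitRingType) :
  is_division_ring D -> has_fourth D ->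
  forall A : 'M[D]_n, prod4_diagonalizable n A.
Proof.
elim/ltn_ind: n D => n IHn D Ddiv Davoid A.
have [n0|n_gt0] := posnP n.
  by subst n; apply: prod4_diagonalizable_companion => // -[].
(* Inner induction on the length still missing from the Hessenberg part; [D] is quantified because a
   transposition passes to the converse ring. *)
suff: forall d k (D : unitRingType), (n - k <= d)%N -> (k < n)%N ->
    is_division_ring D -> has_fourth D ->
    forall A : 'M[D]_n, hessenberg_upto k.+1 A -> prod4_diagonalizable n A.
  by move=> /(_ n 0 D); apply; rewrite ?subn0.
clear D Ddiv Davoid A; elim=> [|d IHd] k D nkd kn Ddiv Davoid A hessA.
  by move: nkd; rewrite leqNgt subn_gt0 kn.
have extend (D' : unitRingType) (B : 'M[D']_n) (i0 j0 : 'I_n) :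
    is_division_ring D' -> has_fourth D' ->
    hessenberg_upto k.+1 B -> j0 = k :> nat -> (k < i0)%N -> B i0 j0 != 0 ->
    prod4_diagonalizable n B.
  move=> Ddiv' Davoid' hessB j0k ki0 B0.
  have [C BC hessC] := hessenberg_extend Ddiv' _ _ _ _ _ hessB j0k ki0 B0.
  apply: prod4_diagonalizable_similar BC _; apply: IHd hessC => //.
    by rewrite subnS -ltnS prednK ?subn_gt0.
  exact: leq_ltn_trans ki0 (ltn_ord i0).
pose j0 := Ordinal kn.
have [/existsP[i0 /andP[ki0 A0]]|noext] :=
  boolP [exists i : 'I_n, (k < i)%N && (A i j0 != 0)].
  exact: (extend D A i0 j0).
have {noext} Ak (i : 'I_n) : (k < i)%N -> A i j0 = 0.
  move=> ki; apply: contraNeq noext => Ai.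
  by apply/existsP; exists i; rewrite ki.
have [m nE] : exists m, n = (k.+1 + m)%N by exists (n - k.+1)%N; rewrite subnKC.
subst n.
pose M := ulsubmx A; pose R := ursubmx A; pose A' := drsubmx A.
have hessM : hessenberg_upto k.+1 M by apply: hessenberg_ulsubmx.
have AE : A = block_mx M R 0 A'.
  rewrite -[LHS]submxK; congr block_mx.
  apply/matrixP => i j; rewrite !mxE.
  have := ltn_ord j; rewrite leq_eqVlt => /orP[/eqP [jk]|jk].
    rewrite (_ : lshift m j = j0); last exact: ord_inj.
    by rewrite Ak //= leq_addr.
  rewrite (proj1 (hessA _ (lshift m j) jk)) //=.
  by rewrite (leq_trans jk) // leq_addr.
have [X R0] := hessenberg_sylvester Ddiv _ _ M A' R hessM.
set R' := R + _ - _ in R0.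
have AB : similar_mx A (block_mx M R' 0 A').
  have P1 := mx_inverse_ublock _ _ _ _ X (@mx_inverse1 D k.+1) (@mx_inverse1 D m).
  rewrite AE; apply: similar_mx_trans (similar_mx_conj _ _ _ P1) _.
  rewrite !mulmx_block !mulmx0 !mul0mx !mul1mx !mulmx1 !addr0 !add0r mulNmx.
  by rewrite mul0mx add0r addrA [M *m X + R]addrC; exact: similar_mx_refl.
apply: prod4_diagonalizable_similar AB _.
have [R'0|] := eqVneq R' 0.
  rewrite R'0.
  (* The matrix decomposes into a Hessenberg block, similar to a companion matrix, and a smaller
     block covered by the outer induction. *)
  apply: (block_diag_closed_prod2 _ (block_diag_closed_prod2 _ diagonalizable_mx_block)).
    have [C MC compC] := hessenberg_similar_companion Ddiv _ _ hessM.
    apply: prod4_diagonalizable_similar MC _.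
    exact: prod4_diagonalizable_companion.
  by apply: IHn; rewrite // addSn ltnS leq_addl.
move=> R'neq0.
have [j R'j] : exists j, R' 0 j != 0.
  apply/existsP; apply: contraNT R'neq0 => /existsPn R'z.
  apply/eqP/row_matrixP => i; rewrite row0; have [->|/R0//] := eqVneq i 0.
  by apply/rowP => j; rewrite mxE [RHS]mxE; apply/eqP; rewrite -[_ == _]negbK.
rewrite -[block_mx _ _ _ _]trmxK.
apply: prod4_diagonalizable_trmx.
pose s := perm (can_inj (@rev_headK k.+1 m)).
apply: (prod4_diagonalizable_similar _ _ _ (similar_mx_perm _ s _)).
have := hessenberg_rev_trmx M R' A' hessM R0.
have -> : \matrix_(x, y) (block_mx M R' 0 A') (rev_head y) (rev_head x)
        = \matrix_(x, y) (block_mx M R' 0 A')^T (s x) (s y) :> 'M[D^c]_(k.+1 + m).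
  by apply/matrixP => x y; rewrite [LHS]mxE 2![RHS]mxE !permE.
(* The nonzero entry in row 0 of [R'] now sits in column [k] below the diagonal, so the Hessenberg
   part grows over [D^c]. *)
move=> hessE; apply: (extend D^c _ (rshift k.+1 j) (lshift m ord_max)) => //.
  by rewrite /= addSn ltnS leq_addr.
rewrite 2!mxE !permE rev_head_lshift rev_head_rshift.
by rewrite (_ : rev_ord ord_max = 0) ?block_mxEur //; apply: val_inj; rewrite /= subnn.
Qed.

Theorem theorem3p2 (D : unitRingType) (n : nat)
    (hdiv : is_division_ring D) (hnc : noncommutative D)
    (hchar : 2%N \in [pchar D]) (hn : (0 < n)%N)
    (hcard : exists s : seq D, uniq s /\ (4 <= size s)%N)
    (A : 'M[D]_n) :
  exists A1 A2 A3 A4 : 'M[D]_n,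
    [/\ diagonalizable_mx A1, diagonalizable_mx A2,
        diagonalizable_mx A3 & diagonalizable_mx A4] /\
    A = A1 *m A2 *m A3 *m A4.
Proof.
have avoid (h : D) : exists e, [/\ e != 0, e != 1 & e != h].
  have [s [s_uniq s4]] := hcard.
  (* A duplicate-free list with all members among three values has length at most 3. *)
  have /allPn[e _ eP] : ~~ all [in [:: 0; 1; h]] s.
    apply: contraL s4 => /allP s_sub; rewrite -ltnNge ltnS.
    exact: (uniq_leq_size s_uniq s_sub).
  by exists e; apply/and3P; move: eP; rewrite !inE !negb_or.
have [_ [_ [[A1 [A2 [d1 d2 ->]]] [A3 [A4 [d3 d4 ->]]] ->]]] :=
  prod4_diagonalizable_all n D hdiv avoid A.
by exists A1, A2, A3, A4; rewrite !mulmxA.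
Qed.
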